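(* For every $d\geq 3$, the homomorphism order of line graphs is universal on the interval $[K_d,K_{d+1})_{\mathcal{L}}$.
   Context: The line graph $L(G)$ of a finite undirected simple graph $G$ is the graph whose vertices are the edges of $G$, two of them adjacent iff they are distinct and share a common endpoint in $G$. For graphs, $A\leq B$ means that there is a graph homomorphism from $A$ to $B$, and $A<B$ means $A\leq B$ and not $B\leq A$; this quasi-order is regarded as a partial order by identifying homomorphically equivalent graphs. $K_n$ is the complete graph on $n$ vertices. $[K_d,K_{d+1})_{\mathcal{L}}$ is the class of all line graphs $L(G)$ of finite graphs $G$ with $K_d\leq L(G)<K_{d+1}$, ordered by $\leq$. A countable partial order is universal if every countable partial order $(P,\leq_P)$ embeds into it, i.e. there is a map $E$ with $a\leq_P b\iff E(a)\leq E(b)$ for all $a,b\in P$. *)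

(* Defs.v *)
From Corelib Require Relation_Definitions.
From mathcomp Require Import all_boot.

Set Implicit Arguments.
Unset Strict Implicit.
Unset Printing Implicit Defensive.

(* The empty graph is allowed. *)
Record sgraph := SGraph {
  vertex :> finType;
  adj : rel vertex;
  adj_sym : symmetric adj;
  adj_irrefl : irreflexive adj }.

Definition edges (G : sgraph) : {set {set G}} :=
  [set e : {set G} | [exists x, exists y, adj x y && (e == [set x; y])]].

Section LineGraph.
Variable G : sgraph.

Definition line_vertex : finType := {e : {set G} | e \in edges G}.

Definition line_adj : rel line_vertex :=
  fun e f => (e != f) && (val e :&: val f != set0).

Lemma line_adj_sym : symmetric line_adj.
Proof. by move=> e f; rewrite /line_adj eq_sym setIC. Qed.

Lemma line_adj_irrefl : irreflexive line_adj.
Proof. by move=> e; rewrite /line_adj eqxx. Qed.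

Definition line_graph : sgraph := SGraph line_adj_sym line_adj_irrefl.

End LineGraph.

Section Complete.
Variable n : nat.

Definition complete_adj : rel 'I_n := fun x y => x != y.

Lemma complete_adj_sym : symmetric complete_adj.
Proof. by move=> x y; rewrite /complete_adj eq_sym. Qed.

Lemma complete_adj_irrefl : irreflexive complete_adj.
Proof. by move=> x; rewrite /complete_adj eqxx. Qed.

Definition complete_graph : sgraph :=
  SGraph complete_adj_sym complete_adj_irrefl.

End Complete.

Definition is_hom (A B : sgraph) (f : A -> B) : Prop :=
  forall x y : A, adj x y -> adj (f x) (f y).

Definition hom_le (A B : sgraph) : Prop := exists f : A -> B, is_hom f.

Definition hom_lt (A B : sgraph) : Prop := hom_le A B /\ ~ hom_le B A.

Lemma hom_le_refl A : hom_le A A.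
Proof. by exists id. Qed.

Lemma hom_le_trans A B C : hom_le A B -> hom_le B C -> hom_le A C.
Proof.
by move=> [f hf] [g hg]; exists (g \o f) => x y /hf /hg.
Qed.

Definition line_interval (d : nat) (A : sgraph) : Prop :=
  exists G : sgraph,
    [/\ A = line_graph G,
        hom_le (complete_graph d) (line_graph G)
      & hom_lt (line_graph G) (complete_graph d.+1)].

(* Countable includes finite and empty. *)
Definition countable_poset (P : Type) (leP : P -> P -> Prop) : Prop :=
  Relation_Definitions.order P leP /\ exists c : P -> nat, injective c.

(* The elements of [C] are taken up to the equivalence [le a b /\ le b a]: *)
(* an embedding into the resulting partial order is given here by          *)
(* representatives, and is injective up to that equivalence because the    *)
(* order of [P] is antisymmetric.                                          *)
Definition universal_on (T : Type) (C : T -> Prop) (le : T -> T -> Prop) :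
    Prop :=
  forall (P : Type) (leP : P -> P -> Prop), countable_poset leP ->
  exists E : P -> T,
    (forall a, C (E a)) /\ (forall a b, leP a b <-> le (E a) (E b)).

(* Main.v *)
Require Import Defs.
From mathcomp Require Import all_boot all_algebra fingroup perm boolp.

Set Implicit Arguments.
Unset Strict Implicit.
Unset Printing Implicit Defensive.
Import GRing.Theory.

(** Unions of oriented cycles, ordered by homomorphism (which exists iff every
cycle length on the left is a multiple of one on the right), form a universal
order, and we encode them into line graphs of graphs of maximal degree [d].
Along every cycle we place vertices of degree [d] ("rims"), each carrying
through a vertex of degree [d] (its "zed") a block of odd size, obtained by
subdividing an edge of a [d]-regular [d]-edge-coloured graph. Two kinds of
blocks, of the same size but not isomorphic, alternate along the cycles.

A homomorphism of line graphs of triangle-free graphs maps the star of a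
vertex of degree [d] onto such a star, hence by linearity over the field with
two elements it maps the edge boundary of a set [X] of such vertices to the
boundary of a set of size at most [#|X|] and of the same parity. The only odd
sets of at most the size of a block with at most [d - 2] boundary edges being
the blocks, blocks are mapped isomorphically onto blocks of the same kind. As
neighbouring rims carry different kinds of blocks, they cannot be identified,
so that the rims are mapped by a covering of cycles. *)

(** * Parity of finite sets *)

Lemma even_card_involution (T : finType) (A : {set T}) (h : T -> T) :
    {in A, forall x, h x \in A} -> {in A, involutive h} ->
    {in A, forall x, h x != x} ->
  ~~ odd #|A|.
Proof.
elim: {A}_.+1 {-2}A (ltnSn #|A|) => // n IH A leAn hA hK hfix.
have [->|[x xA]] := set_0Vmem A; first by rewrite cards0.
have hxA : h x \in A :\ x by rewrite !inE hfix ?hA.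
rewrite (cardsD1 x) xA (cardsD1 (h x)) hxA /= negbK.
have sub y : y \in A :\ x :\ h x -> [/\ y \in A, y != x & y != h x].
  by rewrite !inE => /and3P[].
apply: IH.
- by move: leAn; rewrite (cardsD1 x) xA (cardsD1 (h x)) hxA !ltnS; apply: ltnW.
- move=> y /sub[yA yx yhx]; rewrite !inE hA // andbT.
  apply/andP; split; [apply: contraNneq yx | apply: contraNneq yhx].
    by move/(congr1 h); rewrite !hK // => ->.
  by move=> <-; rewrite hK.
- by move=> y /sub[yA _ _]; apply: hK.
- by move=> y /sub[yA _ _]; apply: hfix.
Qed.

Lemma odd_sum (T : finType) (F : T -> nat) :
  odd (\sum_x F x) = odd #|[set x | odd (F x)]|.
Proof.
rewrite -sum1dep_card [in RHS]big_mkcond /= !(big_morph odd oddD (erefl _)).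
by apply: eq_bigr => x _; case: (odd (F x)).
Qed.

Lemma card_fibers (T U : finType) (h : T -> U) (A : {set T}) :
  #|A| = \sum_u #|[set x in A | h x == u]|.
Proof.
rewrite -sum1_card (partition_big h predT) //=.
by apply: eq_bigr => u _; rewrite -sum1dep_card.
Qed.

(** * Line graphs *)

Section Edges.
Variable G : sgraph.
Implicit Types (x y v : G) (e : {set G}).

Lemma edgesP e : reflect (exists x y, adj x y /\ e = [set x; y]) (e \in edges G).
Proof.
rewrite inE; apply: (iffP existsP) => [[x /existsP[y /andP[xy /eqP->]]]|[x [y [xy ->]]]].
  by exists x, y.
by exists x; apply/existsP; exists y; rewrite xy eqxx.
Qed.

Lemma set2_edge x y : adj x y -> [set x; y] \in edges G.
Proof. by move=> xy; apply/edgesP; exists x, y. Qed.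

Lemma adj_neq x y : adj x y -> x != y.
Proof. by apply: contraTneq => ->; rewrite adj_irrefl. Qed.

Lemma edge_mem e v : e \in edges G -> v \in e ->
  exists2 u, adj v u & e = [set v; u].
Proof.
case/edgesP=> x [y [xy ->]] /set2P[->|->]; first by exists y.
by exists x; rewrite 1?adj_sym // setUC.
Qed.

Lemma edge_mem2 e u v : e \in edges G -> u \in e -> v \in e -> u != v ->
  e = [set u; v].
Proof.
move=> eE /(edge_mem eE)[w _ ->] /set2P[->|->]; last by [].
by rewrite eqxx.
Qed.

Lemma set2_injr v u w : adj v u -> [set v; u] = [set v; w] -> u = w.
Proof.
move=> vu /setP/(_ u); rewrite !inE eqxx orbT => /esym/orP[]/eqP // uv.
by rewrite uv adj_irrefl in vu.
Qed.

Lemma edge_meet e f : e \in edges G -> f \in edges G -> e != f ->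
  e :&: f != set0 ->
  exists a b c, [/\ e = [set a; b], f = [set a; c], adj a b, adj a c & b != c].
Proof.
move=> eE fE nef /set0Pn[a /setIP[ae af]].
have [b ab eb] := edge_mem eE ae; have [c ac fc] := edge_mem fE af.
exists a, b, c; split=> //; apply: contraNneq nef => bc.
by rewrite eb fc bc.
Qed.

End Edges.

Section LineMaps.
Variables G H : sgraph.

(** Homomorphisms of line graphs as total functions on vertex sets, constrained only on edges, which
    avoids the subtype [line_vertex]. *)
Definition line_map (g : {set G} -> {set H}) : Prop :=
  {in edges G, forall e, g e \in edges H} /\
  {in edges G &, forall e f, e != f -> e :&: f != set0 ->
     g e != g f /\ g e :&: g f != set0}.

Lemma hom_le_line_map :
  hom_le (line_graph G) (line_graph H) <-> exists g, line_map g.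
Proof.
split=> [[f fH]|[g [gE gA]]].
  exists (fun e => if insub e is Some e' then val (f e') else set0).
  split=> [e eE|e e' eE eE' ne me]; first by rewrite insubT (valP (f _)).
  rewrite !insubT.
  have /fH/andP[] : @adj (line_graph G) (Sub e eE) (Sub e' eE').
    by rewrite /= /line_adj -val_eqE /= ne me.
  by rewrite -val_eqE.
exists (fun e => Sub (g (val e)) (gE _ (valP e))) => e e' /andP[ne me].
have [] := gA _ _ (valP e) (valP e') ne me.
by rewrite /= /line_adj -val_eqE /= => -> ->.
Qed.

Lemma locally_injective_line_map (h : G -> H) :
    {homo h : x y / adj x y} ->
    (forall x y z, adj x y -> adj x z -> y != z -> h y != h z) ->
  hom_le (line_graph G) (line_graph H).
Proof.
move=> hH hI; apply/hom_le_line_map; exists (fun e : {set G} => h @: e).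
have him x y : h @: [set x; y] = [set h x; h y] by rewrite imsetU1 imset_set1.
split=> [e /edgesP[x [y [xy ->]]]|e f eE fE nef mef].
  by rewrite him; apply/set2_edge/hH.
have [a [b [c [-> -> ab ac bc]]]] := edge_meet eE fE nef mef.
rewrite !him; split; last by apply/set0Pn; exists (h a); rewrite !inE eqxx.
by apply: contraNneq (hI _ _ _ ab ac bc) => /(set2_injr (hH _ _ ab)) ->.
Qed.

End LineMaps.

(** * Graphs with numbered half-edges *)

(** Degrees are [#|K|] or at most 1 and triangles are excluded: for [#|K|] at least 2, this forces
    the cliques of size [#|K|] in the line graph to be the stars of full vertices. *)
Record ported (K : finType) (G : sgraph) (full : pred G) (nb : G -> K -> G) :
    Prop := Ported {
  nb_inj : forall v, full v -> injective (nb v);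
  nb_adj : forall v k, full v -> adj v (nb v k);
  adj_nb : forall v u, full v -> adj v u -> exists k, u = nb v k;
  adj_leaf : forall v u w, ~~ full v -> adj v u -> adj v w -> u = w;
  triangle_free : forall u v w : G, adj u v -> adj v w -> adj w u -> False }.

Section Darts.
Variables (K : finType) (G : sgraph) (nb : G -> K -> G).

Definition dart_edge (p : G * K) : {set G} := [set p.1; nb p.1 p.2].

(** For full vertices, the edge boundary of [S], each edge recorded at its end in [S]. *)
Definition out_darts (S : {set G}) : {set G * K} :=
  [set p | (p.1 \in S) && (nb p.1 p.2 \notin S)].

End Darts.

Section PortedGraph.
Variables (K : finType) (G : sgraph) (full : pred G) (nb : G -> K -> G).
Hypothesis PG : ported full nb.

Lemma dart_edgeE v k : full v -> [set v; nb v k] \in edges G.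
Proof. by move=> fv; apply/set2_edge/(nb_adj PG). Qed.

Lemma port_edge v e : full v -> e \in edges G -> v \in e ->
  exists k, e = [set v; nb v k].
Proof.
move=> fv eE /(edge_mem eE)[u vu ->].
by have [k ->] := adj_nb PG fv vu; exists k.
Qed.

Lemma port_edge_inj v k l : full v ->
  [set v; nb v k] = [set v; nb v l] -> k = l.
Proof.
by move=> fv /(set2_injr (nb_adj PG k fv)); apply: (nb_inj PG).
Qed.

Lemma dart_edge_inj (S : {set G}) : {in S, forall v, full v} ->
  {in out_darts nb S &, injective (dart_edge nb)}.
Proof.
move=> Sfull [v k] [w l]; rewrite !inE /= => /andP[vS _] /andP[_ lS] e.
have : v \in [set w; nb w l] by rewrite -[[set _; _]]e !inE eqxx.
case/set2P=> [vw|vw]; last by rewrite -vw vS in lS.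
by subst w; congr (_, _); apply: port_edge_inj e; apply: Sfull.
Qed.

Lemma leaf_edge v e f : ~~ full v -> e \in edges G -> f \in edges G ->
  v \in e -> v \in f -> e = f.
Proof.
move=> lv eE fE /(edge_mem eE)[u vu ->] /(edge_mem fE)[w vw ->].
by rewrite (adj_leaf PG lv vu vw).
Qed.

(* Pairwise intersecting edges form a star, triangles being excluded. *)
Lemma clique_star (J : finType) (e : J -> {set G}) : 1 < #|J| ->
    (forall j, e j \in edges G) ->
    (forall i j, i != j -> e i != e j /\ e i :&: e j != set0) ->
  exists2 a, full a &
    exists2 q : J -> K, injective q & forall j, e j = [set a; nb a (q j)].
Proof.
case/card_gt1P=> i [j [_ _ ij]] eE eA.
have [ne me] := eA i j ij.
have [a [b [c [eb ec ab ac bc]]]] := edge_meet (eE i) (eE j) ne me.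
have ae k : a \in e k.
  have [->|ki] := eqVneq k i; first by rewrite eb !inE eqxx.
  have [->|kj] := eqVneq k j; first by rewrite ec !inE eqxx.
  apply: contraT => ak.
  have mem l d : k != l -> e l = [set a; d] -> d \in e k.
    move=> kl el; have [_ /set0Pn[x]] := eA k l kl.
    rewrite inE el !inE => /andP[xk /orP[]/eqP xE]; last by rewrite -xE.
    by rewrite -xE xk in ak.
  have /edgesP[x [y [xy]]] := eE k.
  rewrite (edge_mem2 (eE k) (mem _ _ ki eb) (mem _ _ kj ec) bc) => bcE.
  have adj_bc : adj b c.
    have /(edge_mem (eE k))[u bu] := mem _ _ ki eb.
    rewrite (edge_mem2 (eE k) (mem _ _ ki eb) (mem _ _ kj ec) bc) => /esym.
    by move/(set2_injr bu) => <-.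
  by case: (triangle_free PG ab adj_bc); rewrite adj_sym.
have fa : full a.
  apply: contraNT ne => la.
  by rewrite (leaf_edge la (eE i) (eE j) (ae i) (ae j)).
exists a => //.
have /fin_all_exists[q qE] k : exists l, e k = [set a; nb a l].
  exact: port_edge (ae k).
exists q => // k l kl; apply: contraTeq isT => /eA[].
by rewrite !qE kl eqxx.
Qed.

Lemma complete_le_line (v : G) : full v ->
  hom_le (complete_graph #|K|) (line_graph G).
Proof.
move=> fv.
exists (fun i : 'I_#|K| => Sub [set v; nb v (enum_val i)] (dart_edgeE _ fv)) => i j ij.
rewrite /= /line_adj -val_eqE /=; apply/andP; split.
  by apply: contraNneq ij => /(port_edge_inj fv)/enum_val_inj->.
by apply/set0Pn; exists v; rewrite !inE eqxx.
Qed.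

Lemma complete_nle_line n : 1 < n -> #|K| < n ->
  ~ hom_le (complete_graph n) (line_graph G).
Proof.
move=> n1 Kn [f fH].
have [|i|i j ij|a _ [q /leq_card]] := @clique_star 'I_n (fun i => val (f i)).
- by rewrite card_ord.
- exact: valP.
- by have /andP[] := fH i j ij; rewrite -val_eqE.
by rewrite card_ord leqNgt Kn.
Qed.

(** [col] is a proper edge colouring given on half-edges. An edge takes its colour from some full
    end, and the second hypothesis makes the choice of the end immaterial. *)
Lemma line_le_complete (C : finType) (col : G -> K -> C) :
    (forall v, full v -> injective (col v)) ->
    (forall v w k l, full v -> full w -> nb v k = w -> nb w l = v ->
       col v k = col w l) ->
    (forall u v, adj u v -> full u || full v) ->
  hom_le (line_graph G) (complete_graph #|C|).
Proof.
move=> colI colC fullE.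
have col_edge v w k l : full v -> full w ->
    [set v; nb v k] = [set w; nb w l] -> col v k = col w l.
  move=> fv fw e; have : v \in [set w; nb w l] by rewrite -e !inE eqxx.
  case/set2P=> vw; first by subst w; rewrite (port_edge_inj fv e).
  apply: colC => //; apply: (set2_injr (nb_adj PG k fv)).
  by rewrite e -vw setUC.
have ex (e : line_vertex G) :
    exists p, full p.1 && (val e == dart_edge nb p).
  have eE := valP e; have /edgesP[u [v [uv ev]]] := eE.
  have [] := orP (fullE _ _ uv) => [fu|fv].
    have [|k ek] := port_edge fu eE; first by rewrite ev !inE eqxx.
    by exists (u, k); rewrite fu; apply/eqP.
  have [|k ek] := port_edge fv eE; first by rewrite ev !inE eqxx orbT.
  by exists (v, k); rewrite fv; apply/eqP.
pose P e := xchoose (ex e).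
have PE e : full (P e).1 /\ val e = [set (P e).1; nb (P e).1 (P e).2].
  by have /andP[? /eqP] := xchooseP (ex e).
exists (fun e => enum_rank (col (P e).1 (P e).2)) => e f /andP[ne me].
rewrite /= /complete_adj; apply: contraNneq ne => /enum_rank_inj ce.
have [/set0Pn[w]] := me; rewrite inE => /andP[we wf].
have [fP eP] := PE e; have [fQ fP'] := PE f; apply/eqP/val_inj.
(* No two distinct edges meet at a leaf; at a full vertex [col w] separates them. *)
have [fw|lw] := boolP (full w); last exact: leaf_edge lw (valP e) (valP f) we wf.
have [k ek] := port_edge fw (valP e) we.
have [l fl] := port_edge fw (valP f) wf.
rewrite /= in ek fl *; rewrite ek fl.
have -> // : k = l; apply: (colI w fw).
rewrite -(col_edge (P e).1 w (P e).2 k) -?(col_edge (P f).1 w (P f).2 l) //.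
  by rewrite -fl.
by rewrite -ek.
Qed.

End PortedGraph.

(** * Action of a homomorphism on stars *)

Section StarMap.
Variables (K : finType).
Variables (G : sgraph) (full : pred G) (nb : G -> K -> G).
Variables (H : sgraph) (full' : pred H) (nb' : H -> K -> H).
Hypotheses (PG : ported full nb) (PH : ported full' nb').
Variable g : {set G} -> {set H}.
Hypothesis gL : line_map g.

Let gE e : e \in edges G -> g e \in edges H.
Proof. by case: gL => gE _; apply: gE. Qed.

(** [phi v] is meant as the centre of the star containing the images of the edges at [v]. *)
Definition star_map (phi : G -> H) : Prop := forall v, full v ->
  full' (phi v) /\ (forall e, e \in edges G -> v \in e -> phi v \in g e).

Lemma star_map_exists (v0 : G) : full v0 -> 1 < #|K| -> exists phi, star_map phi.
Proof.
move=> fv0 K1.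
have img v : full v ->
    exists a, full' a /\ (forall e, e \in edges G -> v \in e -> a \in g e).
  move=> fv.
  have [k|k l kl|a fa [q _ qE]] :=
    clique_star PH (e := fun k => g [set v; nb v k]) K1.
  - exact/gE/(dart_edgeE PG).
  - apply: (proj2 gL); rewrite ?(dart_edgeE PG) //.
      by apply: contraNneq kl => /(port_edge_inj PG fv)->.
    by apply/set0Pn; exists v; rewrite !inE eqxx.
  exists a; split=> // e eE /(port_edge PG fv eE)[k ->].
  by rewrite qE !inE eqxx.
(* [w0] only serves as a dummy value of [phi] where a vertex is not full. *)
have [w0 _] := img v0 fv0.
suff /fin_all_exists[phi phiP] v : exists a, full v ->
    full' a /\ (forall e, e \in edges G -> v \in e -> a \in g e) by exists phi.
have [/img[a aP]|] := boolP (full v); first by exists a.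
by exists w0.
Qed.

Variable phi : G -> H.
Hypothesis phiP : star_map phi.

Lemma star_full v : full v -> full' (phi v).
Proof. by case/phiP. Qed.

Lemma star_mem v e : full v -> e \in edges G -> v \in e -> phi v \in g e.
Proof. by move=> /phiP[_]; apply. Qed.

Lemma star_inj v e f : e \in edges G -> f \in edges G ->
  v \in e -> v \in f -> g e = g f -> e = f.
Proof.
move=> eE fE ve vf gef; have [//|nef] := eqVneq e f.
have [|ne _] := proj2 gL e f eE fE nef; last by rewrite gef eqxx in ne.
by apply/set0Pn; exists v; rewrite inE ve.
Qed.

(** Edges at [v] have distinct images at [phi v], and both vertices have their ports numbered by
    [K]; the resulting injection of [K] into itself is bijective. *)
Lemma star_surj v e' : full v -> e' \in edges H -> phi v \in e' ->
  exists2 u, adj v u & g [set v; u] = e'.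
Proof.
move=> fv e'E ve'.
have /fin_all_exists[q qE] k :
    exists l, g [set v; nb v k] = [set phi v; nb' (phi v) l].
  have eE := dart_edgeE PG k fv.
  apply: (port_edge PH (star_full fv) (gE eE)).
  by apply: star_mem; rewrite // !inE eqxx.
have [|q' _ q'K] := @injF_bij _ q.
  move=> k l kl; apply: (port_edge_inj PG fv); apply: (star_inj (v := v)).
  - exact: (dart_edgeE PG).
  - exact: (dart_edgeE PG).
  - by rewrite !inE eqxx.
  - by rewrite !inE eqxx.
  by rewrite !qE kl.
have [l ->] := port_edge PH (star_full fv) e'E ve'.
by exists (nb v (q' l)); rewrite ?qE ?q'K //; apply: (nb_adj PG).
Qed.

Lemma star_edge u v : full u -> full v -> adj u v -> phi u != phi v ->
  g [set u; v] = [set phi u; phi v].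
Proof.
move=> fu fv uv; apply: edge_mem2; first exact/gE/set2_edge.
  by apply: star_mem; rewrite ?set2_edge // !inE eqxx.
by apply: star_mem; rewrite ?set2_edge // !inE eqxx orbT.
Qed.

Lemma star_adj u v : full u -> full v -> adj u v -> phi u != phi v ->
  adj (phi u) (phi v).
Proof.
move=> fu fv uv ne; have := gE (set2_edge uv).
rewrite star_edge // => /edge_mem/(_ (set21 _ _))[w aw].
by move/esym/(set2_injr aw) <-.
Qed.

(* Over the field with two elements, [push] is the image of [X] under [phi], *)
(* and stars being mapped to stars, it commutes with taking edge boundaries. *)
Definition push (X : {set G}) : {set H} :=
  [set w | odd #|[set v in X | phi v == w]|].

Lemma odd_push X : odd #|push X| = odd #|X|.
Proof. by rewrite (card_fibers phi X) odd_sum. Qed.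

Lemma push_sub X : push X \subset phi @: X.
Proof.
apply/subsetP => w; rewrite inE => oddw.
have /set0Pn[v] : [set v in X | phi v == w] != set0.
  by apply: contraTneq oddw => ->; rewrite cards0.
by rewrite inE => /andP[vX /eqP<-]; apply: imset_f.
Qed.

Lemma card_push X : #|push X| <= #|X|.
Proof. exact: leq_trans (subset_leq_card (push_sub X)) (leq_imset_card _ _). Qed.

Lemma push_full (X : {set G}) :
  {in X, forall v, full v} -> {in push X, forall w, full' w}.
Proof.
by move=> Xf w /(subsetP (push_sub X))/imsetP[v /Xf fv ->]; apply: star_full.
Qed.

(** [push X] lies in [phi @: X], which has at most [#|X|] elements, so both bounds are attained. *)
Lemma push_bij (X : {set G}) : #|push X| = #|X| ->
  {in X &, injective phi} /\ phi @: X = push X.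
Proof.
move=> eqX; have := push_sub X.
have /leqif_refl := subset_leqif_cards (push_sub X).
rewrite eqX => le1 sub.
have le2 := leq_imset_card phi X.
have e2 : #|phi @: X| = #|X|.
  by apply/eqP; rewrite eqn_leq le2 -eqX subset_leq_card.
split; first by apply/imset_injP/eqP.
by apply/esym/eqP; rewrite eqEcard sub e2 eqX leqnn.
Qed.

(** If no boundary edge of [X] lay above the boundary edge [e'] of [push X], the edges above [e']
    would match in pairs the vertices of [X] sent to an end of [e']. Their number is odd, however,
    since exactly one end of [e'] is in [push X]. *)
Lemma push_dart (X : {set G}) p : {in X, forall v, full v} ->
    p \in out_darts nb' (push X) ->
  exists2 q, q \in out_darts nb X & g (dart_edge nb q) = dart_edge nb' p.
Proof.
case: p => w l Xf; rewrite inE /= => /andP[wS lS]; apply/exists_eq_inP/contraT.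
rewrite negb_exists_in => /forall_inP noq.
have fw := push_full Xf wS.
set e' := dart_edge nb' (w, l) in noq *.
have e'E : e' \in edges H by apply: (dart_edgeE PH).
pose A := [set v in X | phi v \in e'].
(* [h v] is the other end of the only edge at [v] above [e']; it stays in [X] because that edge is
   not in the boundary. *)
pose h v := odflt v [pick u | adj v u && (g [set v; u] == e')].
have hP v : v \in A -> [/\ full v, adj v (h v), g [set v; h v] = e' & h v \in X].
  rewrite inE => /andP[vX ve']; have fv := Xf _ vX.
  have [u0 vu0 gu0] := star_surj fv e'E ve'.
  rewrite /h; case: pickP => [u /andP[vu /eqP gu]|/(_ u0)]; last first.
    by rewrite vu0 gu0 eqxx.
  split=> //=; apply: contraT => uX.
  have [k ek] := adj_nb PG fv vu.
  have /noq : (v, k) \in out_darts nb X by rewrite inE /= vX -ek.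
  by rewrite /dart_edge /= -ek gu eqxx.
have hA : {in A, forall v, h v \in A}.
  move=> v vA; have [fv vh gh hX] := hP v vA.
  rewrite inE hX -gh star_mem ?set2_edge ?Xf //.
  by rewrite !inE eqxx orbT.
have /negP[] : ~~ odd #|A|.
  apply: (even_card_involution hA) => v vA; have [_ vh gh _] := hP v vA.
    have [_ hh ghh _] := hP _ (hA _ vA).
    apply: (set2_injr hh); rewrite [RHS]setUC.
    apply: (star_inj (v := h v)); rewrite ?set2_edge ?ghh ?gh //.
      by rewrite !inE eqxx.
    by rewrite !inE eqxx orbT.
  by rewrite eq_sym adj_neq.
(* The fibre over [w] is odd, the one over [nb' w l] is even. *)
have -> : A = [set v in X | phi v == w] :|: [set v in X | phi v == nb' w l].
  by apply/setP => v; rewrite !inE andb_orr.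
rewrite cardsU (_ : _ :&: _ = set0) ?cards0 ?subn0.
  rewrite oddD; rewrite inE in wS; rewrite wS.
  by rewrite inE in lS; rewrite (negbTE lS).
apply/setP => v; rewrite !inE; apply/negP => /andP[/andP[_ /eqP->] /andP[_ wl]].
by rewrite (negbTE (adj_neq (nb_adj PH l fw))) in wl.
Qed.

Lemma card_push_darts (X : {set G}) : {in X, forall v, full v} ->
  #|out_darts nb' (push X)| <= #|out_darts nb X|.
Proof.
move=> Xf; rewrite -(card_in_imset (dart_edge_inj PH (push_full Xf))).
apply: leq_trans (leq_imset_card (g \o dart_edge nb) _).
apply/subset_leq_card/subsetP => _ /imsetP[p /(push_dart Xf)[q qX <-] ->].
exact: (imset_f (g \o dart_edge nb)).
Qed.

End StarMap.

(** * The core of a block *)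

Section Cayley.
Variable m : nat.

Definition site : finType := ('I_3 * 'I_m.+2 * bool)%type.
Definition port : finType := option 'I_m.+2.

Definition shift (k : port) : 'I_3 * 'I_m.+2 :=
  if k is Some j then (0, j)%R else (1, 0)%R.

(** The perfect matchings of a bipartite (m+3)-regular graph. The ports [Some j] form three complete
    bipartite graphs K_(m+2,m+2), one for each element of Z_3, which the matching of port [None]
    links cyclically. *)
Definition mu (k : port) (r : site) : site :=
  if r.2 then ((r.1 - shift k)%R, false) else ((r.1 + shift k)%R, true).

Lemma shift_inj : injective shift.
Proof. by case=> [i|] [j|] // [->]. Qed.

Lemma muK k : involutive (mu k).
Proof. by case=> [a []]; rewrite /mu /= (subrK, addrK). Qed.

Lemma mu_side k r : (mu k r).2 = ~~ r.2.
Proof. by case: r => a []. Qed.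

Lemma mu_neq k r : mu k r != r.
Proof. by apply: contraTneq isT => /(congr1 snd); rewrite mu_side; case: r.2. Qed.

Lemma mu_injl r k l : mu k r = mu l r -> k = l.
Proof.
case: r => a b /(congr1 fst); rewrite /mu; case: b => /= /addrI; last exact: shift_inj.
by move/oppr_inj/shift_inj.
Qed.

(** Going out by port [k] and back by [Some 0], whose shift is zero, translates by [shift k]; these
    translations generate Z_3 x Z_(m+2). *)
Lemma mu_connected (T : {set site}) r0 : r0 \in T ->
  (forall r k, r \in T -> mu k r \in T) -> T = setT.
Proof.
move=> r0T muT; apply/setP => r; rewrite inE.
have step a k : (a, false) \in T -> ((a + shift k)%R, false) \in T.
  move=> /(muT _ k)/(muT _ (Some 0%R)); rewrite /mu /=.
  by rewrite (_ : (0, 0)%R = 0%R) // subr0.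
have stepn a k n : (a, false) \in T -> ((a + shift k *+ n)%R, false) \in T.
  by elim: n a => [|n IH] a aT; rewrite ?mulr0n ?addr0 // mulrSr addrA step ?IH.
have [a aT] : exists a, (a, false) \in T.
  case: r0 r0T => a [] aT; last by exists a.
  by have /(muT _ None) := aT; exists (a - shift None)%R.
have shiftNn n : (shift None *+ n = (n%:R, 0))%R.
  elim: n => // n IH; rewrite mulrSr IH -natr1 /shift.
  by apply: injective_projections; rewrite /= ?addr0.
(* Port [None] adjusts the first coordinate in [b.1 - a.1] steps, then a single [Some j] adjusts the
   second. *)
have allT b : (b, false) \in T.
  have := step _ (Some (b.2 - a.2)%R) (stepn _ None (b.1 - a.1)%R aT).
  rewrite shiftNn (natr_Zp (b.1 - a.1)%R).
  rewrite (_ : (a + _ + _ = b)%R) //.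
  by apply: injective_projections; rewrite /= !addr0 ![(_ + (_ - _))%R]addrC !subrK.
case: r => b []; last exact: allT.
rewrite (_ : (b, true) = mu (Some 0%R) (b, false)) ?muT ?allT //.
by rewrite /mu /= (_ : (0, 0)%R = 0%R) // addr0.
Qed.

End Cayley.

(** * Necklaces *)

Section Necklace.
Variables (m : nat) (I : finType) (s : {perm I}).

Definition unit_side : finType := (I * bool)%type.
Definition cell : finType := (site m + bool * option 'I_m.+2)%type.
Definition bead : finType := (unit_side * cell)%type.

Implicit Types (b : unit_side) (r : site m) (k : port m) (v : bead).

Definition core b r : bead := (b, inl r).
Definition hub (h : bool) b : bead := (b, inr (h, None)).
(* Leaves with [j = 0] or [j = 1] are isolated: these ports of a hub lead *)
(* elsewhere, and the other [m] ports bring its degree up to [m.+3].      *)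
Definition leaf (h : bool) b (j : 'I_m.+2) : bead := (b, inr (h, Some j)).
Notation zed := (hub false).
Notation rim := (hub true).

(* On side [false] the subdivided edge lies on no 4-cycle of the core. *)
Definition cut_port (t : bool) : port m := if t then Some 0%R else None.
(** [h] selects one of the two ends of the subdivided edge. *)
Definition cut_site (t h : bool) : site m :=
  if h then mu (cut_port t) (0%R, false) else (0%R, false).

Arguments cut_port : simpl never.
Arguments cut_site : simpl never.

(** Together with [rim_mate] this arranges the rims as (i, false), (i, true), (s i, false), (s i,
    true), and so on: a cycle of [s] of length n > 1 becomes a cycle of 2n rims with alternating
    sides. *)
Definition rim_next b : unit_side :=
  (if b.2 then s b.1 else (s^-1)%g b.1, ~~ b.2).
Definition rim_mate b : unit_side := (b.1, ~~ b.2).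

Definition is_cut (t : bool) r k : bool :=
  (k == cut_port t) && ((r == cut_site t false) || (r == cut_site t true)).

Definition nb v k : bead :=
  let: (b, c) := v in
  match c with
  | inl r => if is_cut b.2 r k then zed b else core b (mu k r)
  | inr (h, None) =>
    match k with
    | None => if h then rim (rim_mate b) else core b (cut_site b.2 false)
    | Some j =>
      if j == 0%R then
        if h then rim (rim_next b) else core b (cut_site b.2 true)
      else if j == 1%R then hub (~~ h) b else leaf h b j
    end
  | inr (_, Some _) => v
  end.

Definition full v : bool := if v.2 is inr (_, Some _) then false else true.

(* The port through which [nb v k] sees [v]. *)
Definition back v k : port m :=
  let: (b, c) := v in
  match c with
  | inl r => if is_cut b.2 r k then
               if r == cut_site b.2 false then None else Some 0%R
             else k
  | inr (h, _) => if ~~ h && ((k == None) || (k == Some 0%R))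
                  then cut_port b.2 else k
  end.

Variant full_spec : bead -> Type :=
  | FullCore b r : full_spec (core b r)
  | FullHub h b : full_spec (hub h b).

Lemma fullP v : full v -> full_spec v.
Proof. by case: v => b [r|[h [j|]]] // _; [apply: FullCore | apply: FullHub]. Qed.

Lemma cut_site_neq t : cut_site t true != cut_site t false.
Proof. exact: mu_neq. Qed.

Lemma mu_cut_site t h : mu (cut_port t) (cut_site t h) = cut_site t (~~ h).
Proof. by case: h; rewrite //= muK. Qed.

Lemma is_cutP t r k :
  reflect (k = cut_port t /\ exists h, r = cut_site t h) (is_cut t r k).
Proof.
apply: (iffP andP) => [[/eqP-> /orP[]/eqP->]|[-> [h ->]]].
- by split=> //; exists false.
- by split=> //; exists true.
by split=> //; case: h; rewrite eqxx ?orbT.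
Qed.

Lemma is_cut_mu t r k : is_cut t (mu k r) k = is_cut t r k.
Proof.
apply/is_cutP/is_cutP => -[-> [h e]]; split=> //; exists (~~ h).
  by rewrite -mu_cut_site -e muK.
by rewrite e mu_cut_site.
Qed.

Lemma nb_back v k : full v -> full (nb v k) -> nb (nb v k) (back v k) = v.
Proof.
case/fullP=> [b r|h b] /=.
  case: is_cutP => [[_ [h ->]]|nc] _ /=.
    by case: h => //=; rewrite (negbTE (cut_site_neq _)).
  by rewrite is_cut_mu muK; case: is_cutP nc.
have cutT : is_cut b.2 (cut_site b.2 true) (cut_port b.2).
  by apply/is_cutP; split=> //; exists true.
have cutF : is_cut b.2 (cut_site b.2 false) (cut_port b.2).
  by apply/is_cutP; split=> //; exists false.
case: k => [j|].
  have [->|j0] := eqVneq j 0%R.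
    case: h => /= _; last by rewrite cutT.
    case: b {cutT cutF} => i t; rewrite /rim_next /=.
    by case: t; rewrite /= (permK, permKV).
  have [->|//] := eqVneq j 1%R; by case: h.
case: h => /= _; last by rewrite cutF.
by case: b {cutT cutF} => i []; rewrite /rim_mate.
Qed.

Lemma nb_neq v k : full v -> nb v k != v.
Proof.
have bN b b' : b.2 = ~~ b'.2 -> b != b'.
  by case: b b' => i [] [j []] //= _; apply/eqP; case.
case/fullP=> [b r|h b] /=.
  case: ifP => _; apply/eqP => -[] // /eqP.
  by rewrite (negbTE (mu_neq _ _)).
case: k => [j|]; last by case: h; apply/eqP => -[] // /eqP; rewrite (negbTE (bN _ _ _)).
case: ifP => _; first by case: h; apply/eqP => -[] // /eqP; rewrite (negbTE (bN _ _ _)).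
by case: ifP => _; apply/eqP => -[] //; case: h.
Qed.

(** Symmetrised because [nb] has only a dummy value at leaves. *)
Definition bead_adj : rel bead := fun u v =>
  full u && [exists k, nb u k == v] || full v && [exists k, nb v k == u].

Lemma bead_adj_sym : symmetric bead_adj.
Proof. by move=> u v; rewrite /bead_adj orbC. Qed.

Lemma bead_adj_irrefl : irreflexive bead_adj.
Proof.
move=> v; rewrite /bead_adj orbb; apply/negP => /andP[fv /existsP[k]].
by rewrite (negbTE (nb_neq _ fv)).
Qed.

Definition necklace : sgraph := SGraph bead_adj_sym bead_adj_irrefl.

Lemma adj_full (u v : necklace) :
  full u -> adj u v -> exists k, v = nb u k.
Proof.
move=> fu /orP[/andP[_ /existsP[k /eqP<-]]|/andP[fv /existsP[k /eqP uv]]].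
  by exists k.
by exists (back v k); rewrite -[u in nb u]uv nb_back // uv.
Qed.

Lemma adj_nb_full (v : necklace) k : full v -> adj v (nb v k).
Proof. by move=> fv; apply/orP; left; rewrite fv; apply/existsP; exists k. Qed.

Lemma adj_or_full (u v : necklace) : adj u v -> full u || full v.
Proof. by case/orP=> /andP[-> _]; rewrite ?orbT. Qed.

Lemma nb_leaf v k h b j : full v -> nb v k = leaf h b j -> v = hub h b.
Proof.
case/fullP=> [b' r|h' b'] /=; first by case: ifP.
case: k => [i|]; last by case: h'.
by case: ifP => _; [case: h' | case: ifP => _ // [-> ->]].
Qed.

Lemma adj_leaf_hub h b j (u : necklace) : adj (leaf h b j : necklace) u -> u = hub h b.
Proof.
move=> au; have /orP[//|fu] := adj_or_full au.
by rewrite adj_sym in au; have [k /esym/nb_leaf->] := adj_full fu au.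
Qed.

Lemma adj_core b r (v : necklace) : adj (core b r : necklace) v ->
  v = zed b /\ (exists h, r = cut_site b.2 h) \/
  exists2 k, ~~ is_cut b.2 r k & v = core b (mu k r).
Proof.
case/adj_full=> // k -> /=; case: (boolP (is_cut _ _ _)) => [/is_cutP[_ rE]|nc].
  by left.
by right; exists k.
Qed.

Lemma adj_zed b (v : necklace) : adj (zed b : necklace) v ->
  [\/ exists h, v = core b (cut_site b.2 h), v = rim b | exists j, v = leaf false b j].
Proof.
case/adj_full=> // -[j|] -> /=; last by constructor 1; exists false.
case: ifP => _; first by constructor 1; exists true.
by case: ifP => _; [constructor 2 | constructor 3; exists j].
Qed.

Lemma adj_rim b (v : necklace) : adj (rim b : necklace) v ->
  [\/ v = zed b, exists j, v = leaf true b j |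
      v = rim (rim_mate b) \/ v = rim (rim_next b)].
Proof.
case/adj_full=> // -[j|] -> /=; last by constructor 3; left.
case: ifP => _; first by constructor 3; right.
by case: ifP => _; [constructor 1 | constructor 2; exists j].
Qed.

(** Distinct ports lead to distinct sites, so the subdivided edge was the only one between its
    ends. *)
Lemma cut_sites_nadj b h h' :
  ~~ @adj necklace (core b (cut_site b.2 h)) (core b (cut_site b.2 h')).
Proof.
apply/negP => a; have := adj_neq a; case: (adj_core a) => [[]//|[k nc [e]]] ne.
case/negP: nc; apply/is_cutP; split; last by exists h.
apply: (@mu_injl _ (cut_site b.2 h)); rewrite mu_cut_site -e.
by congr cut_site; case: h h' ne {a e} => [] []; rewrite ?eqxx.
Qed.

Lemma zed_triangle b (u v : necklace) :
  adj (zed b : necklace) u -> adj (zed b : necklace) v -> ~~ adj u v.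
Proof.
have half w : adj (zed b : necklace) w -> ~~ @adj necklace (rim b) w.
  move=> bw; apply/negP => /adj_rim[e|[j e]|[]e]; move: bw; rewrite e.
  - by rewrite adj_irrefl.
  - by rewrite adj_sym => /adj_leaf_hub.
  - by case/adj_zed=> [[]|/(congr1 (fun v : bead => v.1.2))|[]] //=; case: b.2.
  by case/adj_zed=> [[]|/(congr1 (fun v : bead => v.1.2))|[]] //=; case: b.2.
have leafN w j : adj (zed b : necklace) w -> ~~ @adj necklace (leaf false b j) w.
  by move=> bw; apply/negP => /adj_leaf_hub e; move: bw; rewrite e adj_irrefl.
move=> bu bv.
case/adj_zed: (bu) => [[h ue]|->|[j ->]]; [|exact: half|exact: leafN].
case/adj_zed: (bv) => [[h' ->]|->|[j ->]].
- by rewrite ue cut_sites_nadj.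
- by rewrite adj_sym half.
by rewrite adj_sym leafN.
Qed.

(** A 2-colouring that is proper away from the [zed]s. Subdividing creates odd cycles through each
    [zed], so triangles there are excluded by [zed_triangle] instead. *)
Definition tint v : bool :=
  match v.2 with
  | inl r => r.2
  | inr (_, None) => v.1.2
  | inr (_, Some _) => ~~ v.1.2
  end.

Definition is_zed v := v.2 == inr (false, None).

Lemma adj_tint (u v : necklace) :
  adj u v -> ~~ is_zed u -> ~~ is_zed v -> tint u = ~~ tint v.
Proof.
wlog fu : u v / full u.
  move=> th uv uz vz; have /orP[fu|fv] := adj_or_full uv; first exact: th.
  by rewrite (th v u) ?negbK // adj_sym.
case/fullP: fu => [b r|[] b] //.
- by case/adj_core=> [[-> _]|[k _ ->]] // _ _; rewrite /tint /= mu_side negbK.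
by case/adj_rim=> [->|[j ->]|[]->] //; rewrite /tint /= ?negbK.
Qed.

Lemma necklace_triangle (u v w : necklace) :
  adj u v -> adj v w -> adj w u -> False.
Proof.
have zN b (x y : necklace) : adj (zed b : necklace) x -> adj x y ->
    adj y (zed b : necklace) -> False.
  by move=> zx xy; rewrite adj_sym => /(zed_triangle zx); rewrite xy.
have zE x : is_zed x -> x = zed x.1 by case: x => b c /eqP/= ->.
move=> uv vw wu.
have [uz|uz] := boolP (is_zed u); first by move: uv vw wu; rewrite (zE _ uz); apply: zN.
have [vz|vz] := boolP (is_zed v); first by move: vw wu uv; rewrite (zE _ vz); apply: zN.
have [wz|wz] := boolP (is_zed w); first by move: wu uv vw; rewrite (zE _ wz); apply: zN.
have := adj_tint uv uz vz; rewrite (adj_tint vw vz wz) (adj_tint wu wz uz) negbK.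
by case: tint.
Qed.

(** Ports colour the edges properly except for the two halves of a subdivided edge: one half
    inherits the colour of that edge, the other gets the additional colour [None], which makes d+1
    colours. *)
Definition colour v k : option (port m) :=
  let: (b, c) := v in
  match c with
  | inl r => if is_cut b.2 r k then
               if r == cut_site b.2 false then Some (cut_port b.2) else None
             else Some k
  | inr (h, _) => if h then Some k else
      if k == None then Some (cut_port b.2)
      else if k == Some 0%R then None else Some k
  end.

Lemma colour_inj v : full v -> injective (colour v).
Proof.
case/fullP=> [b r|[] b] k l /=.
- case: is_cutP => [[-> hk]|nk]; case: is_cutP => [[-> hl]|nl] //.
  + case: ifP => // _ [e]; by case: nl; rewrite -e.
  + case: ifP => // _ [e]; by case: nk; rewrite e.
  by case.
- by case.
have kt t : cut_port t = None \/ cut_port t = Some 0%R by case: t; [right|left].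
case: k l => [i|] [j|] //=.
- case: eqP => [[->]|ne]; case: eqP => [[->]|ne'] //.
  by case=> ->.
- by case: eqP => // ne [e]; case: (kt b.2) => e'; rewrite e' in e.
by case: eqP => // ne [e]; case: (kt b.2) => e'; rewrite e' in e; case: ne.
Qed.

Lemma colour_back v k : full v -> full (nb v k) ->
  colour (nb v k) (back v k) = colour v k.
Proof.
case/fullP=> [b r|h b] /=.
  case: is_cutP => [[_ [h ->]]|nc] _ /=; last by rewrite is_cut_mu; case: is_cutP nc.
  by case: h => //=; rewrite (negbTE (cut_site_neq _)).
have cut h' : is_cut b.2 (cut_site b.2 h') (cut_port b.2).
  by apply/is_cutP; split=> //; exists h'.
case: k => [j|]; last by case: h => //= _; rewrite cut ?eqxx.
have [->|j0] := eqVneq j 0%R.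
  by case: h => //= _; rewrite cut (negbTE (cut_site_neq _)).
by have [->|//] := eqVneq j 1%R; case: h.
Qed.

Hypothesis sN : forall i, s i != i.

Lemma nb_injective v : full v -> injective (nb v).
Proof.
case/fullP=> [b r|h b] k l /=.
  case: is_cutP => [[-> _]|nk]; case: is_cutP => [[-> _]|nl] //.
  by case=> /mu_injl.
(* A fixed point of [s] would make the two neighbours of a rim on its cycle coincide. *)
have nm : rim (rim_next b) <> rim (rim_mate b).
  move/(congr1 (fun v : bead => v.1.1)); rewrite /rim_next /=.
  case: b.2 => /= e; first by have := sN b.1; rewrite e eqxx.
  by have := sN ((s^-1)%g b.1); rewrite permKV e eqxx.
have cN : core b (cut_site b.2 true) <> core b (cut_site b.2 false).
  by move/(congr1 tint).
case: k l => [i|] [j|] //.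
- have [->|i0] := eqVneq i 0%R; have [->|j0] := eqVneq j 0%R => //.
  + by have [->|j1] := eqVneq j 1%R; case: h.
  + by have [->|i1] := eqVneq i 1%R; case: h.
  have [->|i1] := eqVneq i 1%R; have [->|j1] := eqVneq j 1%R => //.
  by case=> ->.
- have [->|i0] := eqVneq i 0%R; first by case: h.
  by have [->|i1] := eqVneq i 1%R; case: h.
have [->|j0] := eqVneq j 0%R; first by case: h => /esym.
by have [->|j1] := eqVneq j 1%R; case: h.
Qed.

Lemma ported_necklace : @ported (port m) necklace full nb.
Proof.
split.
- exact: nb_injective.
- by move=> v k; apply: adj_nb_full.
- exact: adj_full.
- case=> b [//|[h [j|//]]] u w _ /adj_leaf_hub-> /adj_leaf_hub->; by [].
- exact: necklace_triangle.
Qed.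

Lemma card_port : #|port m| = m.+3.
Proof. by rewrite card_option card_ord. Qed.

Lemma necklace_interval : 0 < #|I| ->
  line_interval m.+3 (line_graph necklace).
Proof.
case/card_gt0P=> i _; have P := ported_necklace.
exists necklace; split=> //.
  rewrite -card_port.
  exact: (complete_le_line P (v := hub true (i, true))).
split; last by apply: (complete_nle_line P); rewrite ?card_port.
have -> : m.+4 = #|{: option (port m)}| by rewrite card_option card_port.
apply: (line_le_complete P colour_inj) => [v w k l fv fw vw wv|]; last exact: adj_or_full.
have e := nb_back fv (k := k); rewrite vw in e.
have -> : l = back v k by apply: (nb_injective fw); rewrite wv e.
by rewrite -vw colour_back // vw.
Qed.

End Necklace.

Arguments cut_port {m} t : simpl never.
Arguments cut_site {m} t h : simpl never.
Arguments core {m I} b r.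
Arguments hub {m I} h b.
Arguments leaf {m I} h b j.
Arguments full {m I} v.
Arguments nb {m I} s v k.
Notation zed := (hub false).
Notation rim := (hub true).

(** * Small edge cuts *)

Section SmallCuts.
Variables (m : nat) (I : finType) (s : {perm I}).
Local Notation G := (necklace m s).
Local Notation nbG := (nb s : G -> port m -> G).
Implicit Types (b : unit_side I) (r : site m) (k : port m) (S : {set G}).

Lemma core_inj b : injective (core b : site m -> G).
Proof. by move=> r r' []. Qed.

Definition block b : {set G} := zed b |: [set core b r | r : site m].

Lemma core_block b r : (core b r : G) \in block b.
Proof. by rewrite !inE imset_f ?orbT. Qed.

Lemma zed_block b : (zed b : G) \in block b.
Proof. by rewrite !inE eqxx. Qed.

Lemma blockP b (v : G) :
  reflect (v = zed b \/ exists r, v = core b r) (v \in block b).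
Proof.
rewrite !inE; apply: (iffP orP) => [[/eqP|/imsetP[r _]]->|[->|[r ->]]].
- by left.
- by right; exists r.
- by left.
by right; apply: imset_f.
Qed.

Lemma block_full b : {in block b, forall v : G, full v}.
Proof. by move=> v /blockP[|[r]] ->. Qed.

Lemma card_block b : #|block b| = #|site m|.+1.
Proof.
rewrite cardsU1 (card_imset _ (@core_inj b)) (_ : _ \notin _) //.
by apply/imsetP => -[r _].
Qed.

Lemma odd_card_block b : odd #|block b|.
Proof. by rewrite card_block /= !card_prod card_bool muln2 odd_double. Qed.

(** The d-2 half-edges of a hub towards its leaves and the other hub of its unit. *)
Definition hub_darts h b : {set G * port m} :=
  [set (hub h b : G, Some j) | j in [pred j : 'I_m.+2 | j != 0%R]].

Lemma card_hub_darts h b : #|hub_darts h b| = m.+1.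
Proof.
rewrite card_imset; last by move=> i j [].
by rewrite cardC1 card_ord.
Qed.

Lemma out_block b : out_darts nbG (block b) \subset hub_darts false b.
Proof.
apply/subsetP => -[v k]; rewrite inE /= => /andP[/blockP[->|[r ->]]] /=; last first.
  by case: ifP => _; rewrite ?zed_block ?core_block.
case: k => [j|]; last by rewrite core_block.
have [->|j0 _] := eqVneq j 0%R; first by rewrite core_block.
exact: imset_f.
Qed.

Lemma hub_darts_out h b S : {in S, forall v : G, full v} ->
  hub h b \in S -> hub (~~ h) b \notin S -> hub_darts h b \subset out_darts nbG S.
Proof.
move=> Sf hS hNS; apply/subsetP => _ /imsetP[j j0 ->]; rewrite inE /= hS.
rewrite (negbTE j0); case: ifP => // _.
by apply/negP => /Sf.
Qed.

Definition core_trace S b : {set site m} := [set r | core b r \in S].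

(** An odd set is not closed under the fixed-point-free involution [mu k]. *)
Lemma trace_mu S b k : odd #|core_trace S b| ->
  exists2 r, r \in core_trace S b & mu k r \notin core_trace S b.
Proof.
move=> oT; apply/exists_inP; apply: contraLR oT.
rewrite negb_exists_in => /forall_inP muT.
apply: (even_card_involution (h := mu k)) => r rT; last exact: mu_neq.
  by have := muT r rT; rewrite negbK.
exact: muK.
Qed.

(** Each of the m+3 matchings has an edge leaving the trace; if that edge is subdivided, one of its
    halves leaves [S]. *)
Lemma odd_trace_cut S b : odd #|core_trace S b| ->
  m.+3 <= #|out_darts nbG S|.
Proof.
move=> oT.
have /fin_all_exists[p pP] k : exists p : G * port m, p \in out_darts nbG S /\
    ((exists r, p = (core b r, k)) \/ p.1 = zed b /\ k = cut_port b.2).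
  have [r rT rmu] := trace_mu k oT; rewrite !inE in rT rmu.
  have [cutk|nck] := boolP (is_cut b.2 r k); last first.
    by exists (core b r, k); split; [rewrite inE /= rT (negbTE nck)|left; exists r].
  have [zS|zNS] := boolP ((zed b : G) \in S); last first.
    by exists (core b r, k); split; [rewrite inE /= rT cutk|left; exists r].
  have /is_cutP[ek [h rE]] := cutk.
  rewrite rE ek mu_cut_site in rmu.
  (* The port of the [zed] towards the end of the subdivided edge that is outside [S]. *)
  exists (zed b, if h then None else Some 0%R); split; last by right.
  by rewrite inE /= zS /=; case: h rmu {rE}.
have pI : injective p.
  move=> k l e; case: (pP k) (pP l) => _ pk [_]; rewrite -e.
  by case: pk => [[r ->]|[pz kE]] [[r' e']|[pz' lE]] //; [case: e' | rewrite e' in pz | rewrite kE].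
rewrite -(card_port m) -(card_codom pI); apply/subset_leq_card/subsetP.
by move=> _ /codomP[k ->]; case: (pP k).
Qed.

(** Among half-edges starting in [block b], those that stay in it. *)
Definition internal b (p : G * port m) : bool :=
  (p.1.1 == b) &&
  match p.1.2 with
  | inl _ => true
  | inr (h, _) => ~~ h && ((p.2 == None) || (p.2 == Some 0%R))
  end.

(** Blocks are connected, by [mu_connected]. *)
Lemma internal_cut S b : zed b \in S -> core_trace S b != setT ->
  exists2 p, p \in out_darts nbG S & internal b p.
Proof.
move=> zS tN; apply/exists_inP; apply: contraNT tN.
rewrite negb_exists_in => /forall_inP no; apply/eqP.
have out p : internal b p -> p.1 \in S -> nb s p.1 p.2 \in S.
  move=> bp pS; apply: contraLR bp => pNS; apply: no.
  by rewrite inE pS.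
have cut h : cut_site b.2 h \in core_trace S b.
  rewrite inE; case: h; last first.
    by apply: (out (zed b, None)); rewrite // /internal /= eqxx.
  by apply: (out (zed b, Some 0%R)); rewrite // /internal /= eqxx.
apply: (mu_connected (cut false)) => r k rT.
have [/is_cutP[-> [h ->]]|nc] := boolP (is_cut b.2 r k).
  by rewrite mu_cut_site.
have := out (core b r, k); rewrite /internal /= eqxx (negbTE nc) inE => -> //.
by rewrite inE in rT.
Qed.

Lemma small_cut_extra h b S p : {in S, forall v : G, full v} ->
    hub h b \in S -> hub (~~ h) b \notin S ->
    p \in out_darts nbG S -> p \notin hub_darts h b ->
  m.+1 < #|out_darts nbG S|.
Proof.
move=> Sf hS hNS pS pN; rewrite -(card_hub_darts h b).
apply/proper_card/properP; split; first exact: hub_darts_out.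
by exists p.
Qed.

Lemma internal_hub_darts h b b' p : internal b p -> p \notin hub_darts h b'.
Proof.
move=> bp; apply/imsetP => -[j j0 e]; move: bp.
by rewrite e /internal /= (inj_eq Some_inj) (negbTE j0) !andbF.
Qed.

Lemma odd_unit S : {in S, forall v : G, full v} -> odd #|S| ->
  exists b, odd ((zed b \in S) + ((rim b \in S) + #|core_trace S b|)).
Proof.
move=> Sf; rewrite (card_fibers (fun v : G => v.1) S) odd_sum => /odd_gt0.
case/card_gt0P=> b; rewrite inE => ob; exists b.
rewrite (cardsD1 (zed b)) (cardsD1 (rim b)) !inE eqxx !andbT /= in ob.
have rz : (rim b : G) != zed b by apply/eqP.
rewrite rz /= in ob; move: ob; congr (odd (_ + (_ + _))).
rewrite -(card_imset _ (@core_inj b)); apply: eq_card => v; rewrite !inE.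
apply/idP/imsetP => [/and4P[vr vz vS /eqP vb]|[r rT ->]]; last first.
  by rewrite inE in rT; apply/and4P; split=> //; apply/eqP.
move: vS (Sf _ vS) vr vz; case: v vb => b' [r|[h [j|]]] //= -> vS _.
  by move=> _ _; exists r; rewrite ?inE.
by case: h vS => _; rewrite eqxx.
Qed.

(** Traces on cores are even, so some unit has exactly one of its two hubs in [S]. The m+1
    half-edges in [hub_darts] of that hub already exhaust the boundary. If the hub is a [zed], its
    whole block lies in [S] and equals it by size. *)
Lemma small_odd_cut S : {in S, forall v : G, full v} -> odd #|S| ->
    #|S| <= #|site m|.+1 -> #|out_darts nbG S| <= m.+1 ->
  exists b, S = block b.
Proof.
move=> Sf oS leS cutS.
have evT b : ~~ odd #|core_trace S b|.
  by apply: contraL cutS => /odd_trace_cut lt; rewrite -ltnNge (leq_trans _ lt).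
have noextra h b p : hub h b \in S -> hub (~~ h) b \notin S ->
    p \in out_darts nbG S -> p \in hub_darts h b.
  move=> hS hNS pS; apply: contraLR cutS => pN; rewrite -ltnNge.
  exact: small_cut_extra hS hNS pS pN.
have full_trace b : zed b \in S ->
    (forall p, internal b p -> p \notin out_darts nbG S) -> block b \subset S.
  move=> zS no; have /setP eT : core_trace S b = setT.
    apply/eqP; apply: contraT => /(internal_cut zS)[p pS /no].
    by rewrite pS.
  apply/subsetP => v /blockP[->//|[r ->]].
  by have := eT r; rewrite !inE.
have [b] := odd_unit Sf oS; rewrite !oddD (negbTE (evT b)) addbF.
have [zS|zNS] := boolP (zed b \in S); have [rS|rNS] := boolP (rim b \in S) => // _.
  exists b; apply/eqP; rewrite eq_sym eqEcard card_block leS andbT.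
  apply: full_trace => // p bp; apply/negP => /(noextra _ _ _ zS rNS).
  by rewrite (negbTE (internal_hub_darts _ _ bp)).
(* If the hub is a [rim], then [S] also contains the neighbouring rim, its [zed] and the block of
   that [zed]: one vertex too many. *)
have noout := noextra true b _ rS zNS; pose b' := rim_mate b.
have rS' : rim b' \in S.
  apply: contraT => rNS'; have /imsetP[] // : (rim b : G, None) \in hub_darts true b.
  by apply: noout; rewrite inE /= rS rNS'.
have zS' : zed b' \in S.
  apply: contraT => zNS'.
  have /imsetP[j _ []] : (rim b' : G, Some 1%R) \in hub_darts true b.
    by apply: noout; rewrite inE /= rS' zNS'.
  by case: b {evT zNS rS noout rS' zNS'} @b' => i [].
have sub : block b' \subset S.
  apply: full_trace => // p bp; apply/negP => /noout.
  by rewrite (negbTE (internal_hub_darts _ _ bp)).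
have : rim b' |: block b' \subset S by rewrite subUset sub1set rS'.
move/subset_leq_card; rewrite cardsU1 card_block.
have -> : rim b' \notin block b' by apply/blockP => -[|[]].
by rewrite ltnNge leS.
Qed.

(* A 5-cycle through the subdividing vertex, that is, a 4-cycle of the core *)
(* graph through the subdivided edge.                                       *)
Definition zed_cycle b : Prop := exists x y p q : G,
  [/\ [/\ x \in block b, y \in block b, p \in block b & q \in block b],
      [/\ adj (zed b : G) x, adj (zed b : G) y & x != y]
    & [/\ adj x p, adj p q & adj q y]].

Lemma block_adj_zed b (v : G) : v \in block b -> adj (zed b : G) v ->
  exists h, v = core b (cut_site b.2 h).
Proof.
case/blockP=> [->|[r ->]]; first by rewrite adj_irrefl.
by case/adj_zed=> [[h ->]||[j]] //; exists h.
Qed.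

Lemma adj_core_core b r r' : adj (core b r : G) (core b r') ->
  exists2 k, ~~ is_cut b.2 r k & r' = mu k r.
Proof. by case/adj_core=> [[]//|[k nc [->]]]; exists k. Qed.

Lemma core_adj b r k : ~~ is_cut b.2 r k -> adj (core b r : G) (core b (mu k r)).
Proof.
by move=> nc; have := @adj_nb_full m I s (core b r) k; rewrite /= (negbTE nc); apply.
Qed.

Lemma adj_zed_cut b h : adj (zed b : G) (core b (cut_site b.2 h)).
Proof.
have := @adj_nb_full m I s (zed b) (if h then Some 0%R else None).
by case: h; apply.
Qed.

(** If neither [k1] nor [k3] is [None], the first coordinate on the left is 0 or -1, and both differ
    from 1 in Z_3; in Z_2 this would fail. *)
Lemma shift_no_cycle (k1 k2 k3 : port m) :
  (shift k1 - shift k2 + shift k3 = shift None)%R -> k1 = None \/ k3 = None.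
Proof.
by case: k1 k3 k2 => [i|] [j|] [k|]; try (by left); try (by right);
  move/(congr1 (fun x => val x.1)).
Qed.

(** On side [true] the subdivided edge comes from a complete bipartite part, hence from a 4-cycle;
    on side [false] it comes from port [None], and [shift_no_cycle] applies. *)
Lemma zed_cycleP b : zed_cycle b <-> b.2.
Proof.
case bt : b.2; split=> //; last first.
  case=> x [y [p [q [[xb yb pb qb] [zx zy xy] [xp pq qy]]]]].
  have zN (u v : G) : adj (zed b : G) u -> adj (zed b : G) v -> ~~ adj u v.
    exact: zed_triangle.
  (* Neighbours of a [zed] are pairwise non-adjacent, so neither [p] nor [q] is the [zed]. *)
  have pcore : exists r, p = core b r.
    case/blockP: pb => // ep; rewrite ep in pq.
    by rewrite (negbTE (zN _ _ pq zy)) in qy.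
  have qcore : exists r, q = core b r.
    case/blockP: qb => // eq; rewrite eq adj_sym in pq.
    by rewrite (negbTE (zN _ _ zx pq)) in xp.
  case: pcore qcore => [r eqp] [r' eqq].
  have [h ex] := block_adj_zed xb zx; have [h' ey] := block_adj_zed yb zy.
  wlog hF : x y p q r r' h h' xb yb pb qb zx zy xy xp pq qy eqp eqq ex ey / h = false.
    move=> th; case hE : h; last exact: (th x y p q r r' h h').
    apply: (th y x q p r' r h' h) => //; do ?[by rewrite adj_sym | by rewrite eq_sym].
    apply: contraNF xy => h'T; rewrite ex ey hE.
    by case: h' {ey} h'T.
  have h'T : h' = true by case: h' ey => // ey; rewrite ex ey hF eqxx in xy.
  rewrite {}ex {}ey {}eqp {}eqq hF h'T in xp pq qy.
  have [k1 nc1 e1] := adj_core_core xp; have [k2 nc2 e2] := adj_core_core pq.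
  have [k3 nc3 e3] := adj_core_core qy.
  have : k1 = None \/ k3 = None.
    apply: (@shift_no_cycle k1 k2); apply: (addrI 0%R).
    move: e3; rewrite e2 e1 bt /cut_site /cut_port /mu => /(congr1 fst)/= ->.
    by rewrite !addrA.
  case=> kN.
    by case/negP: nc1; apply/is_cutP; rewrite bt kN; split=> //; exists false.
  case/negP: nc3; apply/is_cutP; rewrite bt kN; split=> //; exists false.
  by rewrite -[LHS](muK k3) -e3 kN bt; exact: (@mu_cut_site m false true).
(* The ports 1, 0, -1 give the total shift 1 - 0 + (-1) = 0, that of the cut port. *)
move=> _; pose p : site m := mu (Some 1%R) (cut_site b.2 false).
pose q := mu (Some 0%R) p.
have ey : cut_site b.2 true = mu (Some (-1)%R) q.
  rewrite bt /q /p /cut_site /mu /=; congr (_, _).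
  by apply: injective_projections; rewrite /= ?(subr0, add0r) ?subrr ?addr0.
exists (core b (cut_site b.2 false)), (core b (cut_site b.2 true)).
exists (core b p), (core b q).
split; first by rewrite !core_block.
  by rewrite !adj_zed_cut; split=> //; apply/eqP => -[].
rewrite ey; split; apply: core_adj; apply/is_cutP; rewrite bt => -[ek [h e]] //.
  move: e; case: h; last by move/(congr1 snd).
  by move/mu_injl.
by move/(congr1 (odflt 0%R))/eqP: ek; rewrite /= oppr_eq0 oner_eq0.
Qed.

End SmallCuts.

Arguments block {m I} s b.
Arguments zed_cycle m {I} s b.

(** * Rigidity *)

Section Rigidity.
Variables (m : nat) (I J : finType) (s : {perm I}) (t : {perm J}).
Hypotheses (sN : forall i, s i != i) (tN : forall j, t j != j).
Local Notation G := (necklace m s).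
Local Notation H := (necklace m t).
Local Notation nbG := (nb s : G -> port m -> G).
Local Notation nbH := (nb t : H -> port m -> H).
Variables (g : {set G} -> {set H}) (phi : G -> H).
Hypotheses (gL : line_map g) (phiP : star_map (full : pred G) (full : pred H) g phi).

Let PG := ported_necklace m sN.
Let PH := ported_necklace m tN.

Lemma push_block b : exists b', push phi (block s b) = block t b'.
Proof.
have bf := @block_full m I s b.
apply: small_odd_cut.
- exact: (push_full phiP bf).
- by rewrite odd_push odd_card_block.
- by rewrite -(card_block m s b) card_push.
rewrite -(card_hub_darts m s false b).
exact: leq_trans (card_push_darts PG PH gL phiP bf) (subset_leq_card (out_block m s b)).
Qed.

Section Block.
Variables (b : unit_side I) (b' : unit_side J).
Hypothesis pb : push phi (block s b) = block t b'.

Lemma block_bij :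
  {in block s b &, injective phi} /\ phi @: block s b = block t b'.
Proof. by have [] := @push_bij G H phi (block s b); rewrite pb ?card_block. Qed.

Lemma block_map v : v \in block s b -> phi v \in block t b'.
Proof. by move=> vb; rewrite -(proj2 block_bij) imset_f. Qed.

Lemma block_lift w : w \in block t b' -> exists2 v, v \in block s b & phi v = w.
Proof. by rewrite -(proj2 block_bij) => /imsetP[v vb ->]; exists v. Qed.

(** Adjacency is reflected because all neighbours of a core vertex lie in its block: an edge at its
    image lifts to an edge of the block, whose other end is determined by injectivity. *)
Lemma block_adj : {in block s b &, forall u v, adj (phi u) (phi v) = adj u v}.
Proof.
have [inj _] := block_bij.
have up u v : u \in block s b -> v \in block s b -> adj u v -> adj (phi u) (phi v).
  move=> ub vb uv; apply: (star_adj gL phiP (block_full ub) (block_full vb) uv).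
  by rewrite (inj_in_eq inj) // adj_neq.
have down r v : v \in block s b -> adj (phi (core b r : G)) (phi v) -> adj (core b r : G) v.
  move=> vb a.
  have [w uw gw] := star_surj PG PH gL phiP (v := core b r) isT (set2_edge a) (set21 _ _).
  have wb : w \in block s b.
    by case/adj_core: (uw) => [[-> _]|[k _ ->]]; rewrite (zed_block, core_block).
  suff <- : w = v by [].
  apply: (inj) => //; have : phi w \in [set phi (core b r); phi v].
    rewrite -gw; apply: (star_mem phiP (block_full wb) (set2_edge uw)).
    by rewrite !inE eqxx orbT.
  case/set2P=> // /inj e; rewrite e ?core_block // adj_irrefl in uw.
  by [].
move=> u v ub vb; apply/idP/idP; last exact: up.
case/blockP: (ub) => [->|[r ->]]; last exact: down.
case/blockP: (vb) => [->|[r ->]]; first by rewrite adj_irrefl.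
by rewrite adj_sym => /down; rewrite adj_sym; apply; apply: zed_block.
Qed.

(** The edge from [zed b'] to its rim is a boundary edge, so it lifts to a boundary edge of
    [block s b], and these all start at [zed b]. *)
Lemma phi_zed : phi (zed b) = zed b'.
Proof.
have pP : (zed b' : H, Some 1%R) \in out_darts nbH (push phi (block s b)).
  by rewrite pb inE /= zed_block /=; apply/blockP => -[|[]].
have [q qb gq] := push_dart PG PH gL phiP (@block_full m I s b) pP.
have qe : dart_edge nbG q \in edges G /\ q.1 = zed b.
  have /imsetP[j _ ->] := subsetP (out_block m s b) q qb.
  by split=> //; apply: (dart_edgeE PG).
have := star_mem phiP (isT : full (zed b : G)) (proj1 qe).
rewrite gq /dart_edge (proj2 qe) !inE eqxx => /(_ isT)/orP[]/eqP // e.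
have := block_map (zed_block m s b); rewrite e /= => /blockP[|[]] //.
Qed.

Lemma zed_cycle_iff : zed_cycle m s b <-> zed_cycle m t b'.
Proof.
have [inj _] := block_bij.
have zb := zed_block m s b.
split=> [[x [y [p [q [[xb yb pp qb] [zx zy xy] [xp pq qy]]]]]]|].
  exists (phi x), (phi y), (phi p), (phi q); split; first by rewrite !block_map.
    by rewrite -phi_zed !block_adj // (inj_in_eq inj) // zx zy xy.
  by rewrite !block_adj // xp pq qy.
case=> x' [y' [p' [q' [[xb yb pp qb] []]]]].
have [[x xb' <-] [y yb' <-]] := (block_lift xb, block_lift yb).
have [[p pb' <-] [q qb' <-]] := (block_lift pp, block_lift qb).
rewrite -phi_zed !block_adj // (inj_in_eq inj) // => zx zy xy [xp pq qy].
by exists x, y, p, q.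
Qed.

Lemma block_side : b'.2 = b.2.
Proof. by apply/idP/idP => /zed_cycleP/zed_cycle_iff/zed_cycleP. Qed.

(** The edge from [zed b] to its rim goes to an edge at [zed b']. If [phi (rim b)] is its other end,
    this end is no leaf, nor is it in the core, since the edges from [zed b'] to the core are images
    of edges inside the block. That the image is a [rim] follows only in [rim_map]. *)
Lemma phi_rim : exists h, phi (rim b) = hub h b'.
Proof.
have zr : adj (zed b : G) (rim b).
  by have := @adj_nb_full m I s (zed b) (Some 1%R); apply.
have := star_mem phiP (isT : full (zed b : G)) (set2_edge zr) (set21 _ _).
have gE : g [set (zed b : G); rim b] \in edges H by case: gL => gE _; apply/gE/set2_edge.
rewrite phi_zed => /(edge_mem gE)[w zw gw].
have rw : phi (rim b) \in [set (zed b' : H); w].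
  by rewrite -gw; apply: (star_mem phiP (v := rim b)); rewrite ?set2_edge ?set22.
have fr : full (phi (rim b)) by apply: (star_full phiP).
case/set2P: rw => [->|e]; first by exists false.
case/adj_zed: (zw) => [[h ew]|ew|[j ew]]; last by rewrite e ew in fr.
  have [v vb ev] : exists2 v, v \in block s b & phi v = w.
    by apply: block_lift; rewrite ew core_block.
  have zv : adj (zed b : G) v by rewrite -(block_adj (zed_block m s b) vb) phi_zed ev.
  have gv : g [set (zed b : G); v] = [set (zed b' : H); w].
    have ne : phi (zed b) != phi v by rewrite phi_zed ev adj_neq.
    by rewrite (star_edge gL phiP (u := zed b) isT (block_full vb) zv ne) phi_zed ev.
  have : [set (zed b : G); v] = [set (zed b : G); rim b].
    apply: (star_inj gL (v := zed b)); rewrite ?set2_edge ?set21 //.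
    by rewrite gv gw.
  by move/(set2_injr zv) => ve; move: vb; rewrite ve => /blockP[|[]].
by exists true; rewrite e.
Qed.

End Block.
Lemma rim_unit b : exists b', b'.2 = b.2 /\ exists h, phi (rim b) = hub h b'.
Proof.
have [b' pb] := push_block b; exists b'; split; first exact: block_side.
exact: phi_rim pb.
Qed.

Lemma hub_adj h h' (b b' : unit_side J) : b.2 != b'.2 ->
  adj (hub h b : H) (hub h' b') -> h && h'.
Proof.
case: h h' => [] [] //= ne; last by case/adj_zed=> [[]||[]].
  case/adj_rim=> [/(congr1 fst)/= e|[]|[]] //.
  by rewrite e eqxx in ne.
case/adj_zed=> [[]|/(congr1 fst)/= e|[]] //.
by rewrite e eqxx in ne.
Qed.

Lemma adj_mate (b : unit_side I) : adj (rim b : G) (rim (rim_mate b)).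
Proof. by have := @adj_nb_full m I s (rim b) None; apply. Qed.

Lemma adj_next (b : unit_side I) : adj (rim b : G) (rim (rim_next s b)).
Proof. by have := @adj_nb_full m I s (rim b) (Some 0%R); apply. Qed.

(** A rim and its mate have images on different sides, hence distinct and adjacent; adjacent hubs on
    different sides are rims. *)
Lemma rim_map : exists pi : unit_side I -> unit_side J,
  forall b, (pi b).2 = b.2 /\ phi (rim b) = rim (pi b).
Proof.
have /fin_all_exists[pi piP] := rim_unit; exists pi => b.
have [bs [h eh]] := piP b; have [cs [h' eh']] := piP (rim_mate b); split=> //.
have ns : (pi b).2 != (pi (rim_mate b)).2 by rewrite bs cs /=; case: b.2.
have : adj (phi (rim b)) (phi (rim (rim_mate b))).
  apply: (star_adj gL phiP (u := rim b) (v := rim (rim_mate b))) => //.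
    exact: adj_mate.
  by rewrite eh eh'; apply: contraNneq ns => /(congr1 (fun v : H => v.1.2))/= ->.
by rewrite eh eh' => /(hub_adj ns)/andP[-> _].
Qed.

Lemma rim_steps (pi : unit_side I -> unit_side J) b :
    (forall b, (pi b).2 = b.2 /\ phi (rim b) = rim (pi b)) ->
  let c := pi (rim_mate b) in let d := pi (rim_next s b) in
  c = rim_mate (pi b) /\ d = rim_next t (pi b) \/
  c = rim_next t (pi b) /\ d = rim_mate (pi b).
Proof.
move=> piP c d.
have ne x : x.2 = ~~ b.2 -> phi (rim b) != phi (rim x).
  move=> xs; have [[es e] [es' e']] := (piP b, piP x).
  rewrite e e'; apply: contraTneq isT => /(congr1 (fun v : H => v.1.2)) /=.
  by rewrite es es' xs; case: b.2.
have step x : x.2 = ~~ b.2 -> adj (rim b : G) (rim x) ->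
    pi x = rim_mate (pi b) \/ pi x = rim_next t (pi b).
  move=> xs bx; have := star_adj gL phiP (u := rim b) (v := rim x) isT isT bx (ne x xs).
  rewrite (proj2 (piP b)) (proj2 (piP x)) => /adj_rim[|[]|] //.
  by case=> /(congr1 fst); [left|right].
have cd : c <> d.
  move=> e.
  have e1 := star_edge gL phiP (u := rim b) (v := rim (rim_mate b)) isT isT
    (adj_mate b) (ne (rim_mate b) erefl).
  have e2 := star_edge gL phiP (u := rim b) (v := rim (rim_next s b)) isT isT
    (adj_next b) (ne (rim_next s b) erefl).
  have : [set (rim b : G); rim (rim_mate b)] = [set (rim b : G); rim (rim_next s b)].
    apply: (star_inj gL (v := rim b)); rewrite ?set2_edge ?set21 ?adj_mate ?adj_next //.
    by rewrite e1 e2 (proj2 (piP (rim_mate _))) (proj2 (piP (rim_next _ _))) -/c -/d e.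
  move/(set2_injr (adj_mate b))/(congr1 (fun v : G => v.1.1)); rewrite /rim_next /=.
  case: b.2 => /= f; first by have := sN b.1; rewrite -f eqxx.
  by have := sN ((s^-1)%g b.1); rewrite permKV -f eqxx.
have := step (rim_next s b) erefl (adj_next b); have := step (rim_mate b) erefl (adj_mate b).
rewrite -/c -/d => -[]ec [] ed.
- by case: cd; rewrite ec ed.
- by left.
- by right.
by case: cd; rewrite ec ed.
Qed.

(** By [rim_steps] the map of rims never turns back, so it follows a cycle of [t] either forwards or
    backwards throughout. *)
Lemma rim_orbit i : exists j, forall n, (s ^+ n)%g i = i -> (t ^+ n)%g j = j.
Proof.
have [pi piP] := rim_map.
pose f x i := (pi (i, x)).1.
have piE i0 x : pi (i0, x) = (f x i0, x).
  by rewrite [LHS]surjective_pairing (proj1 (piP _)).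
have odd_step i0 : f false i0 = f true i0 /\ f false (s i0) = t (f true i0) \/
    f false i0 = t (f true i0) /\ f false (s i0) = f true i0.
  have := rim_steps (i0, true) piP; rewrite /rim_mate /rim_next /= !piE /=.
  by case=> -[[-> ] [->]]; [left|right].
have even_step i0 : f true (s i0) = f false (s i0) /\ f true i0 = (t^-1)%g (f false (s i0)) \/
    f true (s i0) = (t^-1)%g (f false (s i0)) /\ f true i0 = f false (s i0).
  have := rim_steps (s i0, false) piP; rewrite /rim_mate /rim_next /= permK !piE /=.
  by case=> -[[-> ] [->]]; [left|right].
have tI j : (t^-1)%g j != j.
  by apply: contraNneq (tN ((t^-1)%g j)) => e; rewrite permKV e.
exists (f false i) => n sni.
(* The image of the mate of the starting rim decides the orientation. *)
have [e0|e0] : f true i = f false i \/ f true i = (t^-1)%g (f false i).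
- have := even_step ((s^-1)%g i); rewrite permKV.
  by case=> -[e _]; [left|right].
- suff : f false ((s ^+ n)%g i) = (t ^+ n)%g (f false i) by rewrite sni.
  suff : f true ((s ^+ n)%g i) = f false ((s ^+ n)%g i) /\
         f false ((s ^+ n)%g i) = (t ^+ n)%g (f false i) by case.
  elim: n {sni} => [|n [IH1 IH2]]; first by rewrite !expg0 !perm1.
  rewrite !expgSr !permM -IH2; move: IH1; set i0 := (s ^+ n)%g i => IH1.
  (* Turning back would produce a fixed point of [t]. *)
  have [[_ e]|[e _]] := odd_step i0; last first.
    by have := tN (f true i0); rewrite -e IH1 eqxx.
  rewrite e IH1; split=> //; have [[-> _]|[_ e']] := even_step i0.
    by rewrite e IH1.
  by have := tN (f true i0); rewrite -e -e' eqxx.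
suff : f false ((s ^+ n)%g i) = (t^-1 ^+ n)%g (f false i).
  by rewrite sni => {1}->; rewrite expgVn permKV.
suff : f true ((s ^+ n)%g i) = (t^-1)%g (f false ((s ^+ n)%g i)) /\
       f false ((s ^+ n)%g i) = (t^-1 ^+ n)%g (f false i) by case.
elim: n {sni} => [|n [IH1 IH2]]; first by rewrite !expg0 !perm1.
rewrite !expgSr !permM -IH2; move: IH1; set i0 := (s ^+ n)%g i => IH1.
have [[e _]|[_ e]] := odd_step i0.
  by have := tI (f false i0); rewrite -IH1 e eqxx.
rewrite e IH1; split=> //; have [[_ e']|[-> _]] := even_step i0.
  by have := tI (f false (s i0)); rewrite -e' e eqxx.
by rewrite e IH1.
Qed.

End Rigidity.

Lemma necklace_orbit m (I J : finType) (s : {perm I}) (t : {perm J}) :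
    (forall i, s i != i) -> (forall j, t j != j) ->
    hom_le (line_graph (necklace m s)) (line_graph (necklace m t)) ->
  forall i, exists j, forall n, (s ^+ n)%g i = i -> (t ^+ n)%g j = j.
Proof.
move=> sN tN /hom_le_line_map[g gL] i.
have PG := ported_necklace m sN; have PH := ported_necklace m tN.
have [||phi phiP] := star_map_exists PG PH gL (v0 := hub true (i, true)) => //.
  by rewrite card_port.
exact: (rim_orbit sN tN gL phiP).
Qed.

(** * Coverings and divisibility *)

(** Renaming units by [pi] commutes with [nb], so it is locally injective. *)
Lemma necklace_cover m (I J : finType) (s : {perm I}) (t : {perm J})
    (pi : I -> J) :
    (forall j, t j != j) -> (forall i, pi (s i) = t (pi i)) ->
  hom_le (line_graph (necklace m s)) (line_graph (necklace m t)).
Proof.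
move=> tN pis.
have pisV i : pi ((s^-1)%g i) = (t^-1)%g (pi i).
  by apply: (@perm_inj _ t); rewrite permKV -pis permKV.
pose h (v : necklace m s) : necklace m t := ((pi v.1.1, v.1.2), v.2).
have hfull v : full (h v) = full v by [].
have hnb v k : h (nb s v k) = nb t (h v) k.
  case: v => [[i x] [r|[y [j|]]]] //; first by rewrite /h /=; case: ifP.
  case: k => [j|]; last by case: y.
  rewrite /h /=; case: ifP => _; last by case: ifP.
  by case: y => //; rewrite /rim_next /=; case: x; rewrite /= (pis, pisV).
have PG : forall v w : necklace m s, full v -> adj v w -> exists k, w = nb s v k.
  exact: adj_full.
apply: (locally_injective_line_map (h := h)) => [u v|v x y vx vy].
  wlog fu : u v / full u.
    move=> th uv; have /orP[fu|fv] := adj_or_full uv; first exact: th.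
    by rewrite adj_sym; apply: th => //; rewrite adj_sym.
  move=> uv; have [k ->] := adj_full fu uv; rewrite hnb.
  exact: adj_nb_full.
apply: contraNneq => hxy; have [fv|] := boolP (full v); last first.
  case: v vx vy => b [|[y' [j|]]] // + + _.
  by move=> /adj_leaf_hub-> /adj_leaf_hub->.
move: hxy; have [[k ->] [l ->]] := (adj_full fv vx, adj_full fv vy).
by rewrite !hnb => /(nb_injective tN)->.
Qed.

Section Cycles.
Variables (K : finType) (len : K -> nat).
Local Notation point := {k : K & 'I_(len k)}.

(** One step along a disjoint union of oriented cycles, with one cycle of length [len k] for each
    [k]. *)
Definition turn (x : point) : point := Tagged (fun k => 'I_(len k)) (ordS (tagged x)).

Lemma turn_inj : injective turn.
Proof.
apply: (can_inj (g := fun x => Tagged (fun k => 'I_(len k)) (ord_pred (tagged x)))).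
by case=> k x; rewrite /turn /= ordSK.
Qed.

Definition cycles : {perm point} := perm turn_inj.

Lemma point_eq (x y : point) :
  tag x = tag y -> tagged x = tagged y :> nat -> x = y.
Proof. by case: x y => k x [l y] /= e; case: _ / e y => y /val_inj->. Qed.

Lemma cyclesX n x : tag ((cycles ^+ n)%g x) = tag x /\
  (tagged ((cycles ^+ n)%g x) = (tagged x + n) %% len (tag x) :> nat).
Proof.
elim: n => [|n [IHt IHv]].
  by rewrite expg0 perm1 addn0 modn_small.
rewrite expgSr permM permE; split=> //=.
by rewrite IHv IHt -addn1 modnDml addn1 addnS.
Qed.

Lemma cyclesX_fix n x : (cycles ^+ n)%g x = x <-> len (tag x) %| n.
Proof.
have [et ev] := cyclesX n x; split=> [e|/dvdnP[q ->{et ev}]].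
  move: ev; rewrite e -{1}[tagged x : nat]addn0 -{1}(modn_small (ltn_ord (tagged x))).
  rewrite addn0 => /esym/eqP; rewrite -{2}[tagged x : nat]addn0 eqn_modDl.
  by rewrite mod0n.
have [et ev] := cyclesX (q * len (tag x)) x.
by apply: point_eq => //; rewrite ev addnC modnMDl modn_small.
Qed.

Lemma cycles_neq : (forall k, 1 < len k) -> forall x, cycles x != x.
Proof.
move=> len1 x; apply/eqP; rewrite -[cycles]expg1 cyclesX_fix dvdn1 => /eqP e.
by have := len1 (tag x); rewrite e.
Qed.

End Cycles.

(** A point of cycle [k] returns after [a k] turns, so by [necklace_orbit] some point on the right
    does too. Conversely, reduction modulo [b l] is a covering. *)
Lemma necklace_dvdn m (K L : finType) (a : K -> nat) (b : L -> nat) :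
    (forall k, 1 < a k) -> (forall l, 1 < b l) ->
  hom_le (line_graph (necklace m (cycles a))) (line_graph (necklace m (cycles b)))
  <-> forall k, exists l, b l %| a k.
Proof.
move=> a1 b1; have b0 l : 0 < b l by apply: ltnW.
split=> [ab k|/fin_all_exists[f fP]].
  pose i := Tagged (fun k => 'I_(a k)) (Ordinal (ltnW (a1 k))).
  have [j jP] := necklace_orbit (cycles_neq a1) (cycles_neq b1) ab i.
  by exists (tag j); apply/cyclesX_fix/jP/cyclesX_fix.
pose pi (x : {k : K & 'I_(a k)}) : {l : L & 'I_(b l)} :=
  Tagged (fun l => 'I_(b l)) (Ordinal (ltn_pmod (tagged x) (b0 (f (tag x))))).
apply: (@necklace_cover m _ _ _ _ pi) => [j|x]; first exact: cycles_neq.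
rewrite !permE; apply: point_eq => //=.
by rewrite modn_dvdm // -[in RHS]addn1 modnDml addn1.
Qed.

(** * Encoding of posets *)

Lemma prime_sequence : exists pr : nat -> nat, injective pr /\ forall n, prime (pr n).
Proof.
pose pr n := iter n (fun p => s2val (prime_above p)) 2.
have prS n : pr n < pr n.+1 by rewrite /= ; case: prime_above.
exists pr; split; last by case=> // n; rewrite /=; case: prime_above.
exact/incn_inj/leq_mono/(homo_ltn ltn_trans).
Qed.

Section PosetCode.
Variables (pr : nat -> nat) (r : rel nat).
Hypotheses (pr_inj : injective pr) (pr_prime : forall n, prime (pr n)).

(* Writing [r i j] for [p_i <= p_j], where [p_0, p_1, ...] lists the poset, *)
(* [p_j] gets one cycle of length [upper_code i] for each [p_i <= p_j] with *)
(* [i <= j]; if [j < i], then [upper_code i] is a multiple of that of [j].  *)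
Definition upper_code (i : nat) : nat := \prod_(k < i.+1 | r i k) pr k.

Lemma pr_upper_code k i : (pr k %| upper_code i) = (k <= i) && r i k.
Proof.
rewrite /upper_code Euclid_dvd_prod // big_has_cond.
apply/hasP/andP => [[[k' ki] _ /= /andP[rk]]|[ki rk]].
  by rewrite dvdn_prime2 // => /eqP/pr_inj->.
by exists (Ordinal (ki : k < i.+1)); rewrite ?mem_index_enum //= rk dvdnn.
Qed.

Lemma upper_code_gt1 i : r i i -> 1 < upper_code i.
Proof.
move=> rii; apply: leq_trans (prime_gt1 (pr_prime i)) (dvdn_leq _ _).
  by rewrite prodn_cond_gt0 // => k _; apply: prime_gt0.
by rewrite pr_upper_code leqnn.
Qed.

(** By transitivity every prime factor of the code of [j] is among those of the code of [i]. *)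
Lemma upper_code_dvd i j : transitive r -> j <= i -> r i j ->
  upper_code j %| upper_code i.
Proof.
move=> rT ji rij; rewrite /upper_code (big_ord_widen_cond i.+1 (r j) pr) //.
rewrite [X in _ %| X](bigID (fun k : 'I_i.+1 => r j k && (k < j.+1))) /=.
apply: dvdn_mulr.
rewrite [X in _ %| X](eq_bigl (fun k : 'I_i.+1 => r j k && (k < j.+1))) // => k.
by case rjk : (r j k) => /=; rewrite ?andbF // (rT _ _ _ rij rjk).
Qed.

End PosetCode.

Theorem theorem5p8p3 (d : nat) (hd : 3 <= d) :
  universal_on (line_interval d) hom_le.
Proof.
case: d hd => [|[|[|m]]] // _ P leP [[leR leT _] [c c_inj]].
have [pr [pr_inj pr_prime]] := prime_sequence.
pose r : rel nat := fun i j => `[< exists p q, [/\ c p = i, c q = j & leP p q] >].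
have rP p q : r (c p) (c q) <-> leP p q.
  split=> [/asboolP[p' [q' [/c_inj-> /c_inj->]]] //|pq].
  by apply/asboolP; exists p, q.
have rT : transitive r.
  move=> j i k /asboolP[p [q [<- <- pq]]] /asboolP[q' [u [/c_inj-> <- qu]]].
  by apply/rP; apply: leT qu.
(* [r] is reflexive only on the range of [c]. *)
have r_refl i j : r i j -> r i i.
  by move=> /asboolP[p [q [<- _ _]]]; apply/rP/leR.
pose below p := {k : 'I_(c p).+1 | r k (c p)}.
pose len p (k : below p) := upper_code pr r (val k).
have len1 p k : 1 < len p k.
  by apply: upper_code_gt1 => //; apply: r_refl (valP k).
pose self p : below p := Sub ord_max (proj2 (rP p p) (leR p)).
exists (fun p => line_graph (necklace m (cycles (len p)))); split=> [p|p q].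
  apply: necklace_interval; first by move=> x; apply: cycles_neq.
  apply/card_gt0P; exists (Tagged (fun k => 'I_(len p k)) (Ordinal (ltnW (len1 p (self p))))).
  by [].
rewrite necklace_dvdn //; split=> [/rP pq [k rk]|/(_ (self p))[l dvd]].
  have rkq : r k (c q) := rT _ _ _ rk pq.
  (* If [k] is too large to index a cycle of [q], the code of [c q] itself divides that of [k]. *)
  have [kq|qk] := leqP k (c q); last first.
    by exists (self q); apply: upper_code_dvd rT (ltnW qk) rkq.
  by exists (Sub (Ordinal (kq : k < (c q).+1)) rkq).
have rl : r (val l) (c q) := valP l.
apply/rP; apply: rT (rl).
(* The prime of [l] divides the code of [l], hence that of [c p], which means that [c p] is below
   [l]. *)
have : pr (val (val l)) %| upper_code pr r (c p).
  by apply: dvdn_trans dvd; rewrite pr_upper_code // leqnn (r_refl _ _ rl).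
by rewrite pr_upper_code // => /andP[].
Qed.
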